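(* Let $a=\{a_n\}_{n\ge1}$ be a positive, non-increasing, summable sequence with $\sum_{n\ge1}a_n=1$ such that $$\lim_{n\to\infty}\left(\frac{s_n}{s_{n+1}}\right)^{1/n}=1,\qquad\text{where } s_n=2^{-n}\sum_{i=2^n}^\infty a_i .$$ Then for every $\theta\in[0,1]$, any set $E\in\mathcal{C}_a$ satisfies $$\overline{\dim}_\theta E\le\overline{\dim}_\theta C_a\qquad\text{and}\qquad\underline{\dim}_\theta E\le\underline{\dim}_\theta C_a.$$
   Context: Intermediate dimensions. Write $|U|$ for the diameter of $U\subset\mathbb{R}$. For bounded $F\subseteq\mathbb{R}$ and $\theta\in[0,1]$, the lower $\theta$-intermediate dimension $\underline{\dim}_\theta F$ is the infimum of all $s\ge 0$ such that for every $\epsilon>0$ and every $\delta_0>0$ there exist $0<\delta\le\delta_0$ and a cover $\{U_i\}_{i\in I}$ of $F$ with $\delta^{1/\theta}\le |U_i|\le \delta$ for all $i$ and $\sum_{i}|U_i|^s\le\epsilon$. The upper $\theta$-intermediate dimension $\overline{\dim}_\theta F$ is the infimum of all $s\ge 0$ such that for every $\epsilon>0$ there exists $\delta_0>0$ such that for every $0<\delta\le\delta_0$ there is a cover $\{U_i\}_{i\in I}$ of $F$ with $\delta^{1/\theta}\le |U_i|\le \delta$ for all $i$ and $\sum_{i}|U_i|^s\le\epsilon$. Covers are finite or countable. For $\theta=0$ one reads $\delta^{1/\theta}=0$, i.e. there is no lower restriction on the diameters, and both dimensions equal the Hausdorff dimension. Complementary sets. $\mathcal{C}_a$ is the family of all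 closed sets $E\subset[0,1]$ of the form $E=[0,1]\setminus\bigcup_{j\ge1}U_j$, where $\{U_j\}$ is a disjoint family of open intervals contained in $[0,1]$ with $|U_j|=a_j$ for all $j$. The Cantor set $C_a$ is constructed as follows. In the first step remove from $[0,1]$ an open interval of length $a_1$, leaving two closed intervals $I_{1,1}$ (left) and $I_{1,2}$ (right). After the $k$-th step there are $2^k$ closed intervals $I_{k,1},\dots,I_{k,2^k}$ (numbered from left to right); from each $I_{k,j}$ remove an open interval of length $a_{2^k+j-1}$ to obtain two closed intervals $I_{k+1,2j-1}$ and $I_{k+1,2j}$. The positions of the removed intervals are uniquely determined because the total removed length is $1$: the length of $I_{k,j}$ equals the sum of the lengths of all gaps subsequently removed from it, i.e. $|I_{k,j}|=\sum_{m\ge0}\sum_{i=0}^{2^m-1}a_{2^{k+m}+2^m(j-1)+i}$. Then $C_a=\bigcap_{k\ge1}\bigcup_{j=1}^{2^k}I_{k,j}$. *)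

(* Defs.v *)
From HB Require Import structures.
From mathcomp Require Import all_boot all_order all_algebra.
From mathcomp Require Import all_classical all_reals all_analysis.

Set Implicit Arguments.
Unset Strict Implicit.
Unset Printing Implicit Defensive.

Import Order.TTheory GRing.Theory Num.Theory.
Import numFieldNormedType.Exports.

Local Open Scope classical_set_scope.
Local Open Scope ring_scope.

(* Extended-real valued, so that unbounded sets have diameter +oo; the 0 only
   matters for the empty set, whose diameter is thus 0 rather than -oo. *)
Definition diam (R : realType) (U : set R) : \bar R :=
  ereal_sup (0%E |` [set (`|xy.1 - xy.2|)%:E | xy in U `*` U]).

(* delta ^ (1 / theta), read as 0 when theta = 0 *)
Definition lower_scale (R : realType) (theta delta : R) : R :=
  if theta == 0 then 0 else delta `^ theta^-1.

(* The cover is indexed by an arbitrary I : set nat, hence finite or countable.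
   For an exponent s = 0 the convention is 0 ^ 0 = 1. *)
Definition has_cover (R : realType) (F : set R) (theta s eps delta : R) : Prop :=
  exists (I : set nat) (U : nat -> set R),
    [/\ F `<=` \bigcup_(i in I) U i,
        forall i, I i ->
          ((lower_scale theta delta)%:E <= diam (U i) <= delta%:E)%E
      & (\esum_(i in I) (diam (U i)) `^ s <= eps%:E)%E].

Definition lower_idim (R : realType) (theta : R) (F : set R) : \bar R :=
  ereal_inf [set s%:E | s in [set s : R | 0 <= s /\
    forall eps delta0 : R, 0 < eps -> 0 < delta0 ->
      exists delta : R, 0 < delta <= delta0 /\ has_cover F theta s eps delta]].

Definition upper_idim (R : realType) (theta : R) (F : set R) : \bar R :=
  ereal_inf [set s%:E | s in [set s : R | 0 <= s /\
    forall eps : R, 0 < eps -> exists delta0 : R, 0 < delta0 /\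
      forall delta : R, 0 < delta <= delta0 -> has_cover F theta s eps delta]].

(* Sequences a_1, a_2, ... are functions on nat whose value at 0 is ignored. *)

Definition comp_sets (R : realType) (a : nat -> R) : set (set R) :=
  [set E | closed E /\ exists U : nat -> set R,
    [/\ forall j, (1 <= j)%N -> exists l r : R, U j = `]l, r[%classic,
        forall j, (1 <= j)%N -> U j `<=` `[0, 1]%classic,
        forall j, (1 <= j)%N -> diam (U j) = (a j)%:E,
        trivIset [set j | (1 <= j)%N] U
      & E = `[0, 1]%classic `\` \bigcup_(j in [set j | (1 <= j)%N]) U j]].

(* |I_{k,j}|, for 1 <= j <= 2 ^ k *)
Definition cantor_length (R : realType) (a : nat -> R) (k j : nat) : R :=
  \big[+%R/0]_(0 <= m <oo)
    \sum_(0 <= i < 2 ^ m) a (2 ^ (k + m) + 2 ^ m * j.-1 + i)%N.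

(* Left endpoint of I_{k,j}. The parent of I_{k+1,j} is I_{k,uphalf j}: an odd j
   is a left child; for j even, the left sibling I_{k+1,j-1} and then the gap of
   length a_{2^k + uphalf j - 1} lie between the two left endpoints. *)
Fixpoint cantor_left (R : realType) (a : nat -> R) (k j : nat) : R :=
  if k is k'.+1 then
    if odd j then cantor_left a k' (uphalf j)
    else cantor_left a k' (uphalf j) + cantor_length a k'.+1 j.-1
         + a (2 ^ k' + (uphalf j).-1)%N
  else 0.

Definition cantor_itv (R : realType) (a : nat -> R) (k j : nat) : set R :=
  `[cantor_left a k j, cantor_left a k j + cantor_length a k j]%classic.

Definition cantor_set (R : realType) (a : nat -> R) : set R :=
  \bigcap_(k in [set k | (1 <= k)%N])
    \bigcup_(j in [set j | (1 <= j <= 2 ^ k)%N]) cantor_itv a k j.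

Definition dyadic_tail (R : realType) (a : nat -> R) (n : nat) : R :=
  2 ^- n * \big[+%R/0]_(2 ^ n <= i <oo) a i.

(* Main.v *)
Require Import Defs.
From HB Require Import structures.
From mathcomp Require Import all_boot all_order all_algebra.
From mathcomp Require Import all_classical all_reals all_analysis.
From mathcomp Require Import ring lra zify.

(** Write s_n for dyadic_tail a n, the average length of the 2 ^ n intervals of
    generation n of the Cantor set C_a.  The point is that a cover of C_a by
    sets of many different sizes always contains one size r that is by itself
    good enough to cover every complementary set E economically; so E is covered
    by intervals of exactly that length, and the restrictions on the diameters
    hold because they held for r.

    Let U_i, of diameters r_i < s_1, cover C_a with \sum_i r_i ^ s <= eps; only
    small diameters matter for the dimensions.  The natural probability measure on C_a gives mass 2 ^ - n to each interval of generation
    n, and as a is non-increasing these intervals have length at least s_(n+1)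
    (dyadic_tail_le_cantor_length).  Hence a set of diameter less than s_(n+1)
    has mass at most 4 * 2 ^ - n.  The total mass is 1, so by comparing the
    two sums some i satisfies r_i ^ s <= 16 * eps * 2 ^ - n, where n is the
    generation with s_(n+2) <= r_i < s_(n+1) (cantor_cover_scale).

    On the other side, removing only the 2 ^ m - 1 longest gaps from [0, 1]
    leaves at most 2 ^ m intervals of total length 2 ^ m * s_m containing E, in
    whatever order the gaps are placed.  So E is covered by at most
    2 ^ m * (1 + s_m / r) intervals of length r (comp_set_cover).  With
    m = n + 2 and r = r_i this is at most 8 * 2 ^ n intervals, and the sum of
    their s-th powers is at most 128 * eps.  Any exponent admissible for C_a is
    therefore admissible for E, at the same scales delta.

    The mass is handled without building a measure on C_a: its quantile
    function maps [0, 1[ into C_a, and the mass of a set is the Lebesgue measure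
    of its preimage.  What is needed of it is only that points at distance at
    least 2 / 2 ^ n are sent to points at distance at least s_(n+1)
    (cantor_quantile_expands). *)

Set Implicit Arguments.
Unset Strict Implicit.
Unset Printing Implicit Defensive.

Import Order.TTheory GRing.Theory Num.Theory.
Import numFieldNormedType.Exports.

Local Open Scope classical_set_scope.
Local Open Scope ring_scope.

(** * Tails of the sequence and lengths of the Cantor intervals *)

Lemma partial_sum_le1 (R : realType) (a : nat -> R)
  (a_pos : forall n, (1 <= n)%N -> 0 < a n)
  (a_sum : (\sum_(1 <= i < n) a i) @[n --> \oo] --> (1 : R)) n :
  \sum_(1 <= i < n) a i <= 1.
Proof.
rewrite -(cvg_lim _ a_sum) //.
apply: (nondecreasing_cvgn_le (u_ := fun n => \sum_(1 <= i < n) a i)); last first.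
  by apply/cvg_ex; exists 1.
apply/nondecreasing_seqP => -[|k]; first by rewrite !big_geq.
by rewrite [leRHS]big_nat_recr //= lerDl ltW // a_pos.
Qed.

(** Since the whole series sums to 1, tails are governed by the finite sums
    preceding them. *)
Lemma dyadic_tailE (R : realType) (a : nat -> R)
  (a_sum : (\sum_(1 <= i < n) a i) @[n --> \oo] --> (1 : R)) m :
  2 ^+ m * dyadic_tail a m = 1 - \sum_(1 <= i < 2 ^ m) a i.
Proof.
rewrite /dyadic_tail mulrA divff ?expf_neq0 // mul1r.
apply: cvg_lim => //.
have cv : (fun n => \sum_(1 <= i < n) a i - \sum_(1 <= i < 2 ^ m) a i)
    @ \oo --> 1 - \sum_(1 <= i < 2 ^ m) a i.
  by apply: cvgB => //; exact: cvg_cst.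
apply: cvg_trans cv; apply: near_eq_cvg; near=> n.
rewrite [X in X - _](@big_cat_nat _ _ _ (2 ^ m)) /= ?expn_gt0 //; last first.
  by near: n; exists (2 ^ m)%N.
by rewrite addrAC subrr add0r.
Unshelve. all: by end_near.
Qed.

Lemma dyadic_tail_gt0 (R : realType) (a : nat -> R)
  (a_pos : forall n, (1 <= n)%N -> 0 < a n)
  (a_sum : (\sum_(1 <= i < n) a i) @[n --> \oo] --> (1 : R)) m :
  0 < dyadic_tail a m.
Proof.
rewrite -(@pmulr_rgt0 _ (2 ^+ m)) ?exprn_gt0 // dyadic_tailE // subr_gt0.
apply: lt_le_trans (partial_sum_le1 a_pos a_sum (2 ^ m).+1).
by rewrite [ltRHS]big_nat_recr ?expn_gt0 //= ltrDl a_pos // expn_gt0.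
Qed.

Lemma dyadic_tail_le (R : realType) (a : nat -> R)
  (a_pos : forall n, (1 <= n)%N -> 0 < a n)
  (a_sum : (\sum_(1 <= i < n) a i) @[n --> \oo] --> (1 : R)) m :
  dyadic_tail a m <= 2 ^- m.
Proof.
rewrite -(@ler_pM2l _ (2 ^+ m)) ?exprn_gt0 // dyadic_tailE // divff ?expf_neq0 //.
by rewrite gerBl big_nat_cond sumr_ge0 // => i /andP[/andP[i1 _] _]; rewrite ltW ?a_pos.
Qed.

Lemma sum_dyadic_blocks (R : realType) (a : nat -> R) k M :
  \sum_(0 <= m < M) \sum_(0 <= i < 2 ^ (k + m)) a (2 ^ (k + m) + i)%N =
  \sum_(2 ^ k <= i < 2 ^ (k + M)) a i.
Proof.
elim: M => [|M IH]; first by rewrite addn0 !big_geq.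
rewrite big_nat_recr //= IH addnS.
rewrite [RHS](@big_cat_nat _ _ _ (2 ^ (k + M))) /= ?leq_exp2l ?leq_addr //.
congr (_ + _); rewrite -[in RHS](add0n (2 ^ (k + M))%N) big_addn expnS mul2n -addnn addnK.
by apply: eq_bigr => i _; rewrite addnC.
Qed.

(** Total length of the gaps removed from I_{k,q+1} at step k + m.  Here and
    below, the intervals of generation k are numbered by q = j - 1 >= 0, so that
    the children of q are 2q and 2q + 1. *)
Definition gap_block (R : realType) (a : nat -> R) k q m : R :=
  \sum_(0 <= i < 2 ^ m) a (2 ^ (k + m) + 2 ^ m * q + i)%N.

Lemma gap_block_ge0 (R : realType) (a : nat -> R)
  (a_pos : forall n, (1 <= n)%N -> 0 < a n) k q m : 0 <= gap_block a k q m.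
Proof.
apply: sumr_ge0 => i _; apply/ltW/a_pos.
by rewrite -addnA addn_gt0 expn_gt0.
Qed.

(** By monotonicity the leftmost block is the largest, and it is an initial part
    of the dyadic block of indices between 2 ^ (k + m) and 2 ^ (k + m + 1). *)
Lemma gap_block_le (R : realType) (a : nat -> R)
  (a_pos : forall n, (1 <= n)%N -> 0 < a n)
  (a_noninc : forall m n, (1 <= m)%N -> (m <= n)%N -> a n <= a m) k q m :
  gap_block a k q m <= \sum_(0 <= i < 2 ^ (k + m)) a (2 ^ (k + m) + i)%N.
Proof.
rewrite [leRHS](@big_cat_nat _ _ _ (2 ^ m)) ?leq_exp2l ?leq_addl //=.
apply: ler_wpDr.
  by apply: sumr_ge0 => i _; apply/ltW/a_pos; rewrite addn_gt0 expn_gt0.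
apply: ler_sum => i _; apply: a_noninc; first by rewrite addn_gt0 expn_gt0.
by rewrite leq_add2r leq_addr.
Qed.

Lemma gap_block_cvg (R : realType) (a : nat -> R)
  (a_pos : forall n, (1 <= n)%N -> 0 < a n)
  (a_noninc : forall m n, (1 <= m)%N -> (m <= n)%N -> a n <= a m)
  (a_sum : (\sum_(1 <= i < n) a i) @[n --> \oo] --> (1 : R)) k q :
  cvgn (fun M => \sum_(0 <= m < M) gap_block a k q m).
Proof.
apply: nondecreasing_is_cvgn.
  by apply/nondecreasing_seqP => M; rewrite [leRHS]big_nat_recr //= lerDl gap_block_ge0.
exists 1 => _ [M _ <-].
apply: le_trans (partial_sum_le1 a_pos a_sum (2 ^ (k + M))%N).
apply: (@le_trans _ _ (\sum_(2 ^ k <= i < 2 ^ (k + M)) a i)).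
  by rewrite -sum_dyadic_blocks; apply: ler_sum => m _; exact: gap_block_le.
rewrite [leRHS](@big_cat_nat _ _ _ (2 ^ k)) ?expn_gt0 ?leq_exp2l ?leq_addr //=.
rewrite lerDr big_nat_cond; apply: sumr_ge0 => i /andP[/andP[i1 _] _].
by rewrite ltW ?a_pos.
Qed.

(** The gaps inside I_{k,q+1} are the one at step k and those inside its two
    children. *)
Lemma cantor_length_split (R : realType) (a : nat -> R)
  (a_pos : forall n, (1 <= n)%N -> 0 < a n)
  (a_noninc : forall m n, (1 <= m)%N -> (m <= n)%N -> a n <= a m)
  (a_sum : (\sum_(1 <= i < n) a i) @[n --> \oo] --> (1 : R)) k q :
  cantor_length a k q.+1 = cantor_length a k.+1 q.*2.+1 + a (2 ^ k + q)%N
                           + cantor_length a k.+1 q.*2.+2.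
Proof.
have cvL := @gap_block_cvg R a a_pos a_noninc a_sum k.+1 q.*2.
have cvR := @gap_block_cvg R a a_pos a_noninc a_sum k.+1 q.*2.+1.
apply: cvg_lim => //; rewrite -cvg_shiftS /=.
have H : (fun M => \sum_(0 <= m < M.+1) gap_block a k q m) =
    (fun M => \sum_(0 <= m < M) gap_block a k.+1 q.*2 m) \+ cst (a (2 ^ k + q)%N) \+
    (fun M => \sum_(0 <= m < M) gap_block a k.+1 q.*2.+1 m).
  apply/funext => M /=; rewrite big_nat_recl //.
  have -> : gap_block a k q 0 = a (2 ^ k + q)%N.
    by rewrite /gap_block expn0 big_nat1 addn0 mul1n addn0.
  rewrite addrAC -big_split /= addrC; congr (_ + _); apply: eq_bigr => m _.
  rewrite /gap_block (@big_cat_nat _ _ _ (2 ^ m)) ?leq_exp2l //=; congr (_ + _).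
    apply: eq_bigr => i _; congr a; rewrite addnS addSn !expnS; lia.
  rewrite -[X in \sum_(X <= _ < _) _](add0n (2 ^ m)%N) big_addn expnS mul2n -addnn addnK.
  by apply: eq_bigr => i _; congr a; rewrite addnS addSn !expnS; lia.
rewrite [X in X @ _ --> _]H.
by apply: cvgD => //; apply: cvgD => //; exact: cvg_cst.
Qed.

(** Each gap inside I_{k,q+1} removed at step k + m is at least as long as every
    gap removed at step k + m + 1, anywhere.  There are 2 ^ (k + 1) times as many
    of the latter, so they contribute to the tail from 2 ^ (k + 1) on at most
    2 ^ (k + 1) times what the former contribute to the length. *)
Lemma dyadic_tail_le_cantor_length (R : realType) (a : nat -> R)
  (a_pos : forall n, (1 <= n)%N -> 0 < a n)
  (a_noninc : forall m n, (1 <= m)%N -> (m <= n)%N -> a n <= a m)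
  (a_sum : (\sum_(1 <= i < n) a i) @[n --> \oo] --> (1 : R)) k q :
  (q < 2 ^ k)%N -> dyadic_tail a k.+1 <= cantor_length a k q.+1.
Proof.
move=> qk; set L := cantor_length _ _ _.
rewrite -(@ler_pM2l _ (2 ^+ k.+1)) ?exprn_gt0 // dyadic_tailE // lerBlDr.
have block m : \sum_(0 <= i < 2 ^ (k.+1 + m)) a (2 ^ (k.+1 + m) + i)%N <=
    2 ^+ k.+1 * gap_block a k q m.
  (* c is the first term of the block on the left, and its index exceeds all
     those of the gap block. *)
  set c := a (2 ^ (k.+1 + m))%N.
  apply: (@le_trans _ _ (c *+ (2 ^ (k.+1 + m)))).
    rewrite -[X in _ *+ X]subn0 -iter_addr_0 -big_const_nat.
    by apply: ler_sum => i _; apply: a_noninc; rewrite ?expn_gt0 ?leq_addr.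
  rewrite expnD mulnC mulrnA -[leLHS]mulr_natl natrX ler_wpM2l ?exprn_ge0 //.
  rewrite -[X in _ *+ X]subn0 -iter_addr_0 -big_const_nat.
  apply: ler_sum_nat => i /= im; apply: a_noninc.
    by rewrite -addnA addn_gt0 expn_gt0.
  rewrite addSn [X in (_ <= X)%N]expnS.
  have : (2 ^ m * q.+1 <= 2 ^ (k + m))%N by rewrite addnC expnD leq_mul2l qk orbT.
  by rewrite mulnS; lia.
rewrite -[leLHS](cvg_lim _ a_sum) //; apply: limr_le; first by apply/cvg_ex; exists 1.
apply: nearW => n.
have n2 : (n <= 2 ^ (k.+1 + n))%N.
  apply: leq_trans (ltnW (ltn_expl n (isT : 1 < 2)%N)) _.
  by rewrite leq_exp2l ?leq_addl.
apply: (@le_trans _ _ (\sum_(1 <= i < 2 ^ (k.+1 + n)) a i)).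
  case: n n2 => [|n] n2.
    rewrite big_geq // big_nat_cond sumr_ge0 // => i /andP[/andP[i1 _] _].
    by rewrite ltW ?a_pos.
  rewrite [leRHS](@big_cat_nat _ _ _ n.+1) //= lerDl.
  rewrite big_nat_cond sumr_ge0 // => i /andP[/andP[i1 _] _].
  by rewrite ltW ?a_pos // (leq_trans _ i1).
rewrite [leLHS](@big_cat_nat _ _ _ (2 ^ k.+1)) ?expn_gt0 ?leq_exp2l ?leq_addr //=.
rewrite addrC lerD2r -sum_dyadic_blocks.
apply: (@le_trans _ _ (2 ^+ k.+1 * \sum_(0 <= m < n) gap_block a k q m)).
  by rewrite mulr_sumr; apply: ler_sum => m _; exact: block.
rewrite ler_wpM2l ?exprn_ge0 //.
apply: (nondecreasing_cvgn_le (u_ := fun M => \sum_(0 <= m < M) gap_block a k q m)).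
  by apply/nondecreasing_seqP => M; rewrite [leRHS]big_nat_recr //= lerDl gap_block_ge0.
exact: gap_block_cvg.
Qed.

(** * The quantile function of the Cantor set *)

Lemma cantor_length_ge0 (R : realType) (a : nat -> R)
  (a_pos : forall n, (1 <= n)%N -> 0 < a n)
  (a_noninc : forall m n, (1 <= m)%N -> (m <= n)%N -> a n <= a m)
  (a_sum : (\sum_(1 <= i < n) a i) @[n --> \oo] --> (1 : R)) k q :
  0 <= cantor_length a k q.+1.
Proof.
apply: limr_ge; first exact: (@gap_block_cvg R a a_pos a_noninc a_sum k q).
by apply: nearW => M; apply: sumr_ge0 => m _; exact: gap_block_ge0.
Qed.

Lemma cantor_left_even (R : realType) (a : nat -> R) k q :
  cantor_left a k.+1 q.*2.+1 = cantor_left a k q.+1.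
Proof. by rewrite /= odd_double /= doubleK. Qed.

Lemma cantor_left_odd (R : realType) (a : nat -> R) k q :
  cantor_left a k.+1 q.*2.+2 =
  cantor_left a k q.+1 + cantor_length a k.+1 q.*2.+1 + a (2 ^ k + q)%N.
Proof. by rewrite /= odd_double /= uphalf_double. Qed.

Lemma cantor_right_odd (R : realType) (a : nat -> R)
  (a_pos : forall n, (1 <= n)%N -> 0 < a n)
  (a_noninc : forall m n, (1 <= m)%N -> (m <= n)%N -> a n <= a m)
  (a_sum : (\sum_(1 <= i < n) a i) @[n --> \oo] --> (1 : R)) k q :
  cantor_left a k.+1 q.*2.+2 + cantor_length a k.+1 q.*2.+2 =
  cantor_left a k q.+1 + cantor_length a k q.+1.
Proof.
by rewrite cantor_left_odd (cantor_length_split a_pos a_noninc a_sum k q) !addrA.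
Qed.

(** The parent of the interval numbered q is numbered q./2. *)
Lemma cantor_itv_nested (R : realType) (a : nat -> R)
  (a_pos : forall n, (1 <= n)%N -> 0 < a n)
  (a_noninc : forall m n, (1 <= m)%N -> (m <= n)%N -> a n <= a m)
  (a_sum : (\sum_(1 <= i < n) a i) @[n --> \oo] --> (1 : R)) k q :
  cantor_left a k q./2.+1 <= cantor_left a k.+1 q.+1 /\
  cantor_left a k.+1 q.+1 + cantor_length a k.+1 q.+1 <=
  cantor_left a k q./2.+1 + cantor_length a k q./2.+1.
Proof.
have len k' q' := cantor_length_ge0 a_pos a_noninc a_sum k' q'.
have ga p : 0 <= a (2 ^ k + p)%N by rewrite ltW // a_pos // addn_gt0 expn_gt0.
have := odd_double_half q; case: (odd q) => <-; rewrite half_bit_double ?add0n ?add1n.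
  rewrite cantor_right_odd // cantor_left_odd; split => //.
  by rewrite -addrA lerDl addr_ge0.
rewrite cantor_left_even; split => //.
rewrite lerD2l [leRHS](cantor_length_split a_pos) // -addrA lerDl addr_ge0 //.
Qed.

(** Two consecutive intervals are either siblings, separated by their gap, or
    a right child and the next left child, whose parents are consecutive; whence
    the induction on k.  The bound on q excludes k = 0, where all left endpoints
    are 0. *)
Lemma cantor_itv_ordered (R : realType) (a : nat -> R)
  (a_pos : forall n, (1 <= n)%N -> 0 < a n)
  (a_noninc : forall m n, (1 <= m)%N -> (m <= n)%N -> a n <= a m)
  (a_sum : (\sum_(1 <= i < n) a i) @[n --> \oo] --> (1 : R)) k q :
  (q.+1 < 2 ^ k)%N ->
  cantor_left a k q.+1 + cantor_length a k q.+1 <= cantor_left a k q.+2.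
Proof.
elim: k q => [|k IH] q; first by rewrite expn0.
rewrite -(odd_double_half q); case: (odd q); rewrite ?add0n ?add1n => qk.
  rewrite cantor_right_odd // -doubleS cantor_left_even; apply: IH.
  by move: qk; rewrite expnS; lia.
by rewrite cantor_left_odd cantor_left_even lerDl ltW // a_pos // addn_gt0 expn_gt0.
Qed.

Lemma cantor_left_mono (R : realType) (a : nat -> R)
  (a_pos : forall n, (1 <= n)%N -> 0 < a n)
  (a_noninc : forall m n, (1 <= m)%N -> (m <= n)%N -> a n <= a m)
  (a_sum : (\sum_(1 <= i < n) a i) @[n --> \oo] --> (1 : R)) k p q :
  (p <= q)%N -> (q < 2 ^ k)%N -> cantor_left a k p.+1 <= cantor_left a k q.+1.
Proof.
elim: q => [|q IH]; first by rewrite leqn0 => /eqP->.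
rewrite leq_eqVlt => /predU1P[-> //|pq] qk.
apply: le_trans (IH pq (ltnW qk)) _.
apply: le_trans (cantor_itv_ordered a_pos a_noninc a_sum qk).
by rewrite lerDl cantor_length_ge0.
Qed.

(** The index q of the dyadic interval [q / 2 ^ k, (q + 1) / 2 ^ k[ that
    contains t. *)
Definition dyadic_digits (R : realType) (t : R) (k : nat) : nat :=
  Num.truncn (2 ^+ k * t).

Lemma dyadic_digits_half (R : realType) (t : R) k :
  0 <= t -> (dyadic_digits t k.+1)./2 = dyadic_digits t k.
Proof.
move=> t0; apply/esym/truncn_def.
have := @truncn_itv R (2 ^+ k.+1 * t); rewrite mulr_ge0 ?exprn_ge0 // => /(_ isT).
rewrite -/(dyadic_digits t k.+1); set d := dyadic_digits _ _ => /andP[d1 d2].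
have e : d%:R = (odd d)%:R + 2 * (d./2)%:R :> R.
  by rewrite -{1}(odd_double_half d) natrD -muln2 natrM mulrC; ring.
move: d1 d2; rewrite exprS -!natr1 e; case: (odd d) => /=; rewrite ?mulr1n ?mulr0n => *; lra.
Qed.

Lemma dyadic_digits_lt (R : realType) (t : R) k :
  0 <= t < 1 -> (dyadic_digits t k < 2 ^ k)%N.
Proof.
move=> /andP[t0 t1]; rewrite truncn_lt_nat ?mulr_ge0 ?exprn_ge0 //.
by rewrite natrX gtr_pMr ?exprn_gt0.
Qed.

(** The point of C_a reached by following the binary expansion of t, that is, the
    t-quantile of the measure giving mass 2 ^ - k to each interval of
    generation k. *)
Definition cantor_quantile (R : realType) (a : nat -> R) (t : R) : R :=
  sup (range (fun k => cantor_left a k (dyadic_digits t k).+1)).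

(** The left endpoints along the branch of t increase and are bounded by every
    right endpoint of the branch, so their supremum lies in all its
    intervals. *)
Lemma cantor_quantile_itv (R : realType) (a : nat -> R)
  (a_pos : forall n, (1 <= n)%N -> 0 < a n)
  (a_noninc : forall m n, (1 <= m)%N -> (m <= n)%N -> a n <= a m)
  (a_sum : (\sum_(1 <= i < n) a i) @[n --> \oo] --> (1 : R)) t k :
  0 <= t ->
  cantor_itv a k (dyadic_digits t k).+1 (cantor_quantile a t).
Proof.
move=> t0; rewrite /cantor_itv /= in_itv /=.
pose l k := cantor_left a k (dyadic_digits t k).+1.
pose r k := l k + cantor_length a k (dyadic_digits t k).+1.
rewrite -/(l k) -/(r k).
have lr j : l j <= r j by rewrite lerDl cantor_length_ge0.
have nest j : l j <= l j.+1 /\ r j.+1 <= r j.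
  have := cantor_itv_nested a_pos a_noninc a_sum j (dyadic_digits t j.+1).
  by rewrite dyadic_digits_half.
have lS : {homo l : i j / (i <= j)%N >-> i <= j}.
  by apply/nondecreasing_seqP => j; case: (nest j).
have rS : {homo r : i j / (i <= j)%N >-> j <= i}.
  by apply/nonincreasing_seqP => j; case: (nest j).
have ub j : ubound (range l) (r j).
  move=> _ [i _ <-]; have [ij|/ltnW ji] := leqP i j.
    exact: le_trans (lS _ _ ij) (lr j).
  exact: le_trans (lr i) (rS _ _ ji).
apply/andP; split.
  by apply: ub_le_sup; [exists (r 0%N); exact: ub|exists k].
by apply: ge_sup => //; exists (l 0%N), 0%N.
Qed.

Lemma cantor_set_quantile (R : realType) (a : nat -> R)
  (a_pos : forall n, (1 <= n)%N -> 0 < a n)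
  (a_noninc : forall m n, (1 <= m)%N -> (m <= n)%N -> a n <= a m)
  (a_sum : (\sum_(1 <= i < n) a i) @[n --> \oo] --> (1 : R)) t :
  0 <= t < 1 -> cantor_set a (cantor_quantile a t).
Proof.
move=> /[dup] t01 /andP[t0 _] k _; exists (dyadic_digits t k).+1.
  by rewrite /= dyadic_digits_lt.
exact: cantor_quantile_itv.
Qed.

(** At least one whole interval of generation n separates the branches of t and
    u, and it has length at least dyadic_tail a n.+1. *)
Lemma cantor_quantile_expands (R : realType) (a : nat -> R)
  (a_pos : forall n, (1 <= n)%N -> 0 < a n)
  (a_noninc : forall m n, (1 <= m)%N -> (m <= n)%N -> a n <= a m)
  (a_sum : (\sum_(1 <= i < n) a i) @[n --> \oo] --> (1 : R)) n t u :
  0 <= t -> t + 2 / 2 ^+ n <= u -> u < 1 ->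
  cantor_quantile a t + dyadic_tail a n.+1 <= cantor_quantile a u.
Proof.
move=> t0 tu u1.
have n0 : 0 < 2 ^+ n :> R by rewrite exprn_gt0.
have u0 : 0 <= u by apply: le_trans tu; rewrite addr_ge0 // divr_ge0 // ltW.
have un : (dyadic_digits u n < 2 ^ n)%N by rewrite dyadic_digits_lt // u0.
have dd : (dyadic_digits t n + 2 <= dyadic_digits u n)%N.
  rewrite truncn_ge_nat ?mulr_ge0 ?(ltW n0) // natrD.
  have : (dyadic_digits t n)%:R <= 2 ^+ n * t by rewrite truncn_le mulr_ge0 ?(ltW n0).
  rewrite -(ler_pM2l n0) mulrDr [_ * (2 / _)]mulrC divfK ?gt_eqF // in tu; lra.
have := @cantor_quantile_itv R a a_pos a_noninc a_sum t n t0.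
have := @cantor_quantile_itv R a a_pos a_noninc a_sum u n u0.
rewrite /cantor_itv /= !in_itv /= => /andP[lu _] /andP[_ rt].
move: dd un lu rt; set p := dyadic_digits t n; set q := dyadic_digits u n.
rewrite addn2 => dd un lu rt.
apply: le_trans lu; apply: le_trans (cantor_left_mono a_pos a_noninc a_sum dd un).
have p2 := leq_ltn_trans dd un.
have s1 := cantor_itv_ordered a_pos a_noninc a_sum p2.
have s0 := cantor_itv_ordered a_pos a_noninc a_sum (ltnW p2).
have := dyadic_tail_le_cantor_length a_pos a_noninc a_sum (ltnW p2).
move: s0 s1 rt; clear; lra.
Qed.

(** * A good scale in every cover of the Cantor set *)

(** Countable subadditivity of the mass.  By the expansion property, the preimage
    under the quantile function of a set of diameter less than
    dyadic_tail a n.+1 lies within 2 / 2 ^ n of any of its points, hence has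
    measure at most 4 / 2 ^ n. *)
Lemma cantor_cover_mass (R : realType) (a : nat -> R)
  (a_pos : forall n, (1 <= n)%N -> 0 < a n)
  (a_noninc : forall m n, (1 <= m)%N -> (m <= n)%N -> a n <= a m)
  (a_sum : (\sum_(1 <= i < n) a i) @[n --> \oo] --> (1 : R))
  (I : set nat) (U : nat -> set R) (n : nat -> nat) :
  cantor_set a `<=` \bigcup_(i in I) U i ->
  (forall i, I i -> forall x y, U i x -> U i y ->
    `|x - y| < dyadic_tail a (n i).+1) ->
  (1 <= \big[+%E/0%E]_(0 <= i <oo | i \in I) (4 / 2 ^+ n i : R)%:E)%E.
Proof.
move=> cover small.
have n0 i : 0 < 2 / 2 ^+ n i :> R by rewrite divr_gt0 // exprn_gt0.
have /choice[c cP] : forall i, exists c : R, I i -> forall t, 0 <= t < 1 ->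
    U i (cantor_quantile a t) -> c - 2 / 2 ^+ n i <= t <= c + 2 / 2 ^+ n i.
  (* As centre, any point of the preimage will do. *)
  move=> i; have [[c [Ii c01 Uc]]|none] :=
      pselect (exists t, [/\ I i, 0 <= t < 1 & U i (cantor_quantile a t)]); last first.
    by exists 0 => Ii t t01 Ut; exfalso; apply: none; exists t.
  exists c => _ t t01 Ut; have /andP[c0 c1] := c01; have /andP[t0 t1] := t01.
  have := small i Ii _ _ Uc Ut; rewrite ltr_norml => /andP[lo hi].
  have ct := fun h => @cantor_quantile_expands R a a_pos a_noninc a_sum (n i) c t c0 h t1.
  have tc := fun h => @cantor_quantile_expands R a a_pos a_noninc a_sum (n i) t c t0 h c1.
  apply/andP; split.
    rewrite leNgt; apply/negP => h.
    have /tc : t + 2 / 2 ^+ n i <= c by lra.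
    lra.
  rewrite leNgt; apply/negP => h.
  have /ct : c + 2 / 2 ^+ n i <= t by lra.
  lra.
pose D i : set R :=
  if i \in I then `[c i - 2 / 2 ^+ n i, c i + 2 / 2 ^+ n i]%classic else set0.
have cov : `[0, 1[%classic `<=` \bigcup_i D i.
  move=> t; rewrite /= in_itv /= => t01.
  have [i Ii Ut] := cover _ (cantor_set_quantile a_pos a_noninc a_sum t01).
  by exists i => //; rewrite /D mem_set //= in_itv /= cP.
have mD i : measurable (D i) by rewrite /D; case: ifP => _; [exact: measurable_itv|].
have := measure_sigma_subadditive (@lebesgue_measure R) mD (measurable_itv `[0, 1[) cov.
rewrite [X in (X <= _)%E]lebesgue_measure_itv /= lte_fin ltr01 oppr0 adde0 => /le_trans; apply.
rewrite [leRHS]eseries_mkcond; apply: lee_nneseries => [i _ _|i _]; first exact: measure_ge0.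
rewrite /D; case: ifP => _; last by rewrite measure0.
rewrite [X in (X <= _)%E]lebesgue_measure_itv /= lte_fin ifT; last by have := n0 i; lra.
by rewrite -EFinB lee_fin; lra.
Qed.

Lemma ler_diam (R : realType) (U : set R) (r x y : R) :
  (diam U <= r%:E)%E -> U x -> U y -> `|x - y| <= r.
Proof.
move=> Ur Ux Uy; rewrite -lee_fin; apply: le_trans Ur.
by apply: ereal_sup_ubound; right; exists (x, y).
Qed.

Lemma dyadic_tail_bracket (R : realType) (a : nat -> R)
  (a_pos : forall n, (1 <= n)%N -> 0 < a n)
  (a_sum : (\sum_(1 <= i < n) a i) @[n --> \oo] --> (1 : R)) (r : R) :
  0 < r < dyadic_tail a 1 ->
  exists n, dyadic_tail a n.+2 <= r < dyadic_tail a n.+1.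
Proof.
move=> /andP[r0 r1].
have ex : exists n, dyadic_tail a n.+1 <= r.
  have [N _ /(_ N (leqnn N)) /= N2] :
      \forall n \near \oo, (2^-1 : R) ^+ n < r.
    by apply: (cvgr_lt 0) r0; apply: cvg_expr; rewrite ger0_norm ?invr_ge0 // invf_lt1 // ltr1n.
  exists N; apply: le_trans (ltW N2); apply: (le_trans (dyadic_tail_le a_pos a_sum _)).
  by rewrite -exprVn ler_wiXn2l // ?invr_ge0 // invf_le1 // ler1n.
case: (ex_minnP ex) => -[|n]; first by rewrite leNgt r1.
move=> rn min; exists n; rewrite rn /= ltNge; apply/negP => /min.
by rewrite ltnn.
Qed.

(** If every U i violated the estimate, then for suitable n i the masses
    4 / 2 ^ n i would be dominated by (r i ^ s + eps / 2 ^ (i + 1)) / (4 * eps),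
    whose sum is at most 1 / 2.  The summable term eps / 2 ^ (i + 1) is there
    for the sets of diameter 0, which carry no mass: for them it is enough that
    n i may be chosen arbitrarily large. *)
Lemma cantor_cover_scale (R : realType) (a : nat -> R)
  (a_pos : forall n, (1 <= n)%N -> 0 < a n)
  (a_noninc : forall m n, (1 <= m)%N -> (m <= n)%N -> a n <= a m)
  (a_sum : (\sum_(1 <= i < n) a i) @[n --> \oo] --> (1 : R))
  (theta s eps delta : R) :
  0 < eps -> delta < dyadic_tail a 1 ->
  has_cover (cantor_set a) theta s eps delta ->
  exists r n, [/\ lower_scale theta delta <= r <= delta,
    dyadic_tail a n.+2 <= r < dyadic_tail a n.+1
    & 2 ^+ n * r `^ s <= 16 * eps].
Proof.
move=> eps0 delta1 [I [U [cover scales sum]]].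
have ls0 : 0 <= lower_scale theta delta :> R.
  by rewrite /lower_scale; case: ifP => // _; exact: powR_ge0.
pose r i := fine (diam (U i)).
have rE i : I i -> diam (U i) = (r i)%:E.
  move=> Ii; have /andP[lo hi] := scales i Ii; rewrite fineK // fin_numE.
  by apply/andP; split; [apply: contraTneq lo => ->|apply: contraTneq hi => ->].
have rs i : I i -> lower_scale theta delta <= r i <= delta.
  by move=> Ii; have := scales i Ii; rewrite rE // !lee_fin.
have [i Ii iP] : exists2 i, I i & forall n, r i < dyadic_tail a n.+1 ->
    r i `^ s + eps / 2 ^+ i.+1 < 16 * eps / 2 ^+ n.
  apply: contrapT => no.
  have /choice[n nP] : forall i, exists n, I i -> r i < dyadic_tail a n.+1 /\
      16 * eps / 2 ^+ n <= r i `^ s + eps / 2 ^+ i.+1.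
    move=> i; apply: contrapT => noi; apply: no; exists i.
      by apply: contrapT => nI; apply: noi; exists 0%N.
    move=> n rn; rewrite ltNge; apply/negP => h; apply: noi; exists n => _; by split.
  have : (1 <= \big[+%E/0%E]_(0 <= i <oo | i \in I) (4 / 2 ^+ n i : R)%:E)%E.
    apply: (cantor_cover_mass a_pos a_noninc a_sum cover).
    move=> i Ii x y Ux Uy; apply: le_lt_trans (nP i Ii).1.
    by apply: ler_diam Ux Uy; rewrite rE.
  apply/negP; rewrite -ltNge.
  apply: (@le_lt_trans _ _ (2^-1)%:E); last by rewrite lte_fin invf_lt1 // ltr1n.
  apply: (@le_trans _ _ (\big[+%E/0%E]_(0 <= i <oo | i \in I)
      ((4 * eps)^-1%:E * ((r i `^ s)%:E + (eps / (2 ^ i.+1)%:R)%:E)))%E).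
    apply: lee_nneseries => [i _ _|i].
      by rewrite lee_fin divr_ge0 // exprn_ge0.
    rewrite inE => Ii; rewrite -EFinD -EFinM lee_fin natrX.
    rewrite [leRHS]mulrC ler_pdivlMr ?mulr_gt0 //.
    by have := (nP i Ii).2; lra.
  rewrite nneseriesZl; last first.
    by move=> i _; rewrite -EFinD lee_fin addr_ge0 ?powR_ge0 // divr_ge0 // ltW.
  apply: (@le_trans _ _ ((4 * eps)^-1%:E * (eps%:E + eps%:E))%E).
    apply: lee_wpmul2l; first by rewrite lee_fin invr_ge0 mulr_ge0 // ltW.
    apply: le_trans (epsilon_trick _ _ (ltW eps0)) _ => [i|].
      by rewrite lee_fin powR_ge0.
    rewrite leeD2r //; apply: le_trans sum.
    rewrite nneseries_esum; last by move=> i _; rewrite lee_fin powR_ge0.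
    rewrite (_ : [set x | x \in I] = I); last by apply/seteqP; split => x /=; rewrite inE.
    by apply: le_esum => i Ii; rewrite rE // poweR_EFin.
  rewrite -EFinD -EFinM lee_fin (_ : _ * _ = 2^-1) //.
  by field; rewrite gt_eqF.
have r0 : 0 < r i.
  rewrite lt_neqAle (le_trans ls0) ?andbT; last by have /andP[] := rs i Ii.
  apply/negP => /eqP r0.
  (* At diameter 0 every generation is allowed, and at i + 5 the two sides are
     16 / 2 ^ (i + 5) = 1 / 2 ^ (i + 1), times eps. *)
  have := iP (i + 5)%N; rewrite -r0 dyadic_tail_gt0 // => /(_ isT).
  apply/negP; rewrite -leNgt; apply: (@le_trans _ _ (eps / 2 ^+ i.+1)).
    rewrite (_ : 16 * eps / 2 ^+ (i + 5) = eps / 2 ^+ i.+1) //.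
    by rewrite exprD [in RHS]exprS; field; rewrite expf_neq0.
  by rewrite lerDr powR_ge0.
have r1 : r i < dyadic_tail a 1.
  by have /andP[_ /le_lt_trans] := rs i Ii; apply.
have [|n /[dup] ns /andP[_ rn]] := dyadic_tail_bracket a_pos a_sum (r := r i).
  by rewrite r0.
exists (r i), n; split => //; first exact: rs.
rewrite mulrC -ler_pdivlMr ?exprn_gt0 //.
apply: le_trans (ltW (iP n rn)); rewrite lerDl divr_ge0 ?exprn_ge0 // ltW //.
Qed.

(** * Covering complementary sets at a single scale *)

Lemma diam_cc (R : realType) (p r : R) :
  0 <= r -> diam `[p, p + r]%classic = r%:E.
Proof.
move=> r0; apply/eqP; rewrite eq_le; apply/andP; split.
  apply: ge_ereal_sup => _ [->|[[x y] /= [+ +] <-]]; rewrite lee_fin // !in_itv /=.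
  by rewrite ler_norml => /andP[? ?] /andP[? ?]; lra.
apply: ereal_sup_ubound; right; exists (p + r, p) => /=.
  by rewrite !in_itv /= !lexx !lerDl r0.
by rewrite addrC addKr ger0_norm.
Qed.

(** Positivity of the diameter rules out the empty interval. *)
Lemma diam_oo (R : realType) (l r x : R) :
  0 < x -> diam `]l, r[%classic = x%:E -> l + x = r.
Proof.
move=> x0 D; have [rl|lr] := leP r l.
  suff : (diam `]l, r[%classic <= 0%:E :> \bar R)%E by rewrite D lee_fin leNgt x0.
  apply: ge_ereal_sup => _ [-> //|[[v w] /= [+ _] <-]].
  by rewrite in_itv /= => /andP[/lt_trans h /h]; rewrite ltNge rl.
apply/eqP; rewrite eq_le; apply/andP; split.
  rewrite -lerBrDl -lee_fin -D; apply: ge_ereal_sup => _ [->|[[u v] /= [+ +] <-]].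
    by rewrite lee_fin; lra.
  by rewrite !in_itv /= lee_fin ler_norml => /andP[? ?] /andP[? ?]; lra.
rewrite leNgt; apply/negP => h.
pose eta := (r - l - x) / 4.
have : `|(r - eta) - (l + eta)| <= x.
  by apply: (@ler_diam _ `]l, r[%classic); rewrite ?D // /= in_itv /= /eta; lra.
by rewrite ler_norml => /andP[_]; rewrite /eta; lra.
Qed.

Definition covered_by (R : realType) (r : R) (pts : seq R) (F : set R) : Prop :=
  forall t, F t -> exists2 p, p \in pts & p <= t <= p + r.

Lemma cover_itv (R : realType) (r c d : R) : 0 < r -> c <= d ->
  exists2 pts, (size pts)%:R <= 1 + (d - c) / r & covered_by r pts `[c, d]%classic.
Proof.
move=> r0 cd.
exists [seq c + r * k%:R | k <- iota 0 (Num.truncn ((d - c) / r)).+1].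
  rewrite size_map size_iota -natr1 addrC lerD2l truncn_le.
  by rewrite divr_ge0 ?subr_ge0 // ltW.
move=> t; rewrite set_itvE => /andP[ct td].
have tc : 0 <= (t - c) / r by rewrite divr_ge0 ?subr_ge0 // ltW.
exists (c + r * (Num.truncn ((t - c) / r))%:R).
  apply: (map_f (fun k => c + r * k%:R)); rewrite mem_iota /= add0n ltnS le_truncn //.
  by rewrite ler_pM2r ?invr_gt0 // lerB.
have /andP[] := truncn_itv tc; rewrite ler_pdivlMr // ltr_pdivrMr // -natr1.
by move=> h1 h2; apply/andP; split; lra.
Qed.

(** Removing k disjoint gaps from an interval leaves k + 1 pieces, and a piece of
    length L needs at most 1 + L / r intervals.  The induction avoids sorting the
    gaps: an arbitrary gap g splits the remaining ones into those on its left
    and those on its right. *)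
Lemma cover_minus_gaps (R : realType) (T : eqType) (l u : T -> R) (r : R) :
  0 < r -> forall (G : seq T) (c d : R), c <= d -> uniq G ->
  {in G, forall i, [&& c <= l i, l i < u i & u i <= d]} ->
  {in G &, forall i j, i != j -> u i <= l j \/ u j <= l i} ->
  exists2 pts, (size pts)%:R <= (size G).+1%:R + (d - c - \sum_(i <- G) (u i - l i)) / r
    & covered_by r pts (`[c, d]%classic `\` [set t | exists2 i, i \in G & l i < t < u i]).
Proof.
move=> r0 G; have [n] := ubnP (size G); elim: n G => // n IH [|g G] /= sG c d cd.
  move=> _ _ _; have [pts ptsN ptsC] := cover_itv r0 cd.
  by exists pts => [|t [/ptsC]]; rewrite ?big_nil ?subr0.
move=> /andP[gG uG] sub dis.
have /and3P[cg gg gd] := sub g (mem_head _ _).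
pose L := [seq i <- G | u i <= l g]; pose H := [seq i <- G | ~~ (u i <= l g)].
have subG i : i \in G -> [&& c <= l i, l i < u i & u i <= d].
  by move=> iG; apply: sub; rewrite inE iG orbT.
have disG : {in G &, forall i j, i != j -> u i <= l j \/ u j <= l i}.
  by move=> i j iG jG; apply: dis; rewrite inE ?iG ?jG orbT.
have size_split : (size G = size L + size H)%N.
  by rewrite !size_filter count_predC.
have sum_split : \sum_(i <- G) (u i - l i) =
    \sum_(i <- L) (u i - l i) + \sum_(i <- H) (u i - l i).
  by rewrite (bigID (fun i => u i <= l g)) /= !big_filter.
have [||||pL pLN pLC] := IH L _ c (l g) cg.
- by lia.
- exact: filter_uniq.
- move=> i; rewrite mem_filter => /andP[ig iG].
  by have /and3P[-> ->] := subG i iG.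
- by move=> i j; rewrite !mem_filter => /andP[_ iG] /andP[_ jG]; exact: disG.
have [||||pH pHN pHC] := IH H _ (u g) d gd.
- by lia.
- exact: filter_uniq.
- move=> i; rewrite mem_filter => /andP[ig iG].
  have /and3P[_ -> ->] := subG i iG; rewrite !andbT.
  have ng : i != g by apply: contraNneq gG => <-.
  have igG : i \in g :: G by rewrite inE iG orbT.
  have [h|//] := dis i g igG (mem_head _ _) ng.
  by rewrite h in ig.
- by move=> i j; rewrite !mem_filter => /andP[_ iG] /andP[_ jG]; exact: disG.
exists (pL ++ pH).
  rewrite size_cat natrD big_cons sum_split size_split.
  apply: le_trans (lerD pLN pHN) _; rewrite -!natr1 natrD.
  rewrite le_eqVlt; apply/orP; left; apply/eqP.
  by field; rewrite gt_eqF.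
move=> t [] /=; rewrite in_itv /= => /andP[ct td] nt.
have [tg|gt] := leP t (l g).
  have [|p pin pt] := pLC t; last by exists p => //; rewrite mem_cat pin.
  split; first by rewrite /= in_itv /= ct.
  move=> [i]; rewrite mem_filter => /andP[_ iG] it; apply: nt.
  by exists i => //; rewrite inE iG orbT.
have [tg|tg] := ltP t (u g).
  by exfalso; apply: nt; exists g; rewrite ?mem_head // gt.
have [|p pin pt] := pHC t; last by exists p => //; rewrite mem_cat pin orbT.
split; first by rewrite /= in_itv /= tg.
move=> [i]; rewrite mem_filter => /andP[_ iG] it; apply: nt.
by exists i => //; rewrite inE iG orbT.
Qed.

(** The gaps of index less than 2 ^ m leave at most 2 ^ m pieces, of total length
    2 ^ m * dyadic_tail a m. *)
Lemma comp_set_cover (R : realType) (a : nat -> R)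
  (a_pos : forall n, (1 <= n)%N -> 0 < a n)
  (a_sum : (\sum_(1 <= i < n) a i) @[n --> \oo] --> (1 : R)) (E : set R) r m :
  comp_sets a E -> 0 < r ->
  exists2 pts, (size pts)%:R <= 2 ^+ m * (1 + dyadic_tail a m / r)
    & covered_by r pts E.
Proof.
move=> [_ [U [Uitv U01 Udiam Utriv ->]]] r0.
have /choice[lu luP] : forall j, exists lu : R * R, (1 <= j)%N ->
    U j = `]lu.1, lu.2[%classic.
  move=> j; have [/Uitv [x [y xy]]|] := leqP 1 j; first by exists (x, y).
  by move=> _; exists (0, 0).
pose l j := (lu j).1; pose u j := (lu j).2.
have UE j : (1 <= j)%N -> U j = `]l j, u j[%classic by exact: luP.
have len j : (1 <= j)%N -> l j + a j = u j.
  by move=> j1; apply: diam_oo; rewrite ?a_pos // -UE // Udiam.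
have lt_lu j : (1 <= j)%N -> l j < u j by move=> j1; rewrite -len // ltrDl a_pos.
have memG j : j \in index_iota 1 (2 ^ m) -> (1 <= j)%N.
  by rewrite mem_index_iota => /andP[].
have [|||pts ptsN ptsC] :=
    @cover_minus_gaps R nat l u r r0 (index_iota 1 (2 ^ m)) 0 1 ler01.
- exact: iota_uniq.
- move=> j /memG j1; rewrite lt_lu //=; have lj := lt_lu j j1.
  (* Were an endpoint outside [0, 1], so would be the midpoint of the part of the
     gap that sticks out. *)
  have in01 t : l j < t < u j -> 0 <= t <= 1.
    by move=> tj; have := U01 j j1 t; rewrite UE //= !in_itv /=; exact.
  apply/andP; split; rewrite leNgt; apply/negP => h.
    have := in01 ((l j + Num.min 0 (u j)) / 2).
    by case: (leP 0 (u j)) => uj H; have /andP[] := H ltac:(lra); lra.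
  have := in01 ((u j + Num.max 1 (l j)) / 2).
  by case: (leP 1 (l j)) => l1 H; have /andP[] := H ltac:(lra); lra.
- move=> i j /memG i1 /memG j1 ij.
  have [|h1] := leP (u i) (l j); first by left.
  have [|h2] := leP (u j) (l i); first by right.
  exfalso; move/eqP: ij; apply; apply: Utriv => //.
  have li := lt_lu i i1; have lj := lt_lu j j1.
  exists ((Num.max (l i) (l j) + Num.min (u i) (u j)) / 2).
  by rewrite !UE //; split; rewrite /= in_itv /=;
    case: (leP (l i) (l j)) => ?; case: (leP (u i) (u j)) => ?; lra.
exists pts.
  apply: le_trans ptsN _; rewrite size_iota subn1 prednK ?expn_gt0 //.
  rewrite natrX mulrDr mulr1 lerD2l mulrA dyadic_tailE // subr0.
  rewrite big_seq (eq_bigr a) -?big_seq // => j /memG j1.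
  by rewrite -len // addrC addKr.
move=> t [t01 tU]; apply: ptsC; split => // -[j /memG j1 tj]; apply: tU.
by exists j => //; rewrite UE //= in_itv.
Qed.

(** As all the intervals have length r, the bounds on the diameters only need
    to be checked for r. *)
Lemma has_cover_of_points (R : realType) (theta s eps delta r : R) (F : set R) pts :
  0 <= r -> lower_scale theta delta <= r <= delta ->
  covered_by r pts F -> (size pts)%:R * r `^ s <= eps ->
  has_cover F theta s eps delta.
Proof.
move=> r0 scale ptsC sum.
exists `I_(size pts), (fun i => `[nth 0 pts i, nth 0 pts i + r]%classic); split.
- move=> t /ptsC[p pin pt]; exists (index p pts); first by rewrite /= index_mem.
  by rewrite nth_index //= in_itv.
- by move=> i _; rewrite diam_cc // !lee_fin.
rewrite esum_fset //; last by move=> i _; exact: poweR_ge0.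
rewrite -fsbig_ord (eq_bigr (fun=> (r `^ s)%:E)); last first.
  by move=> i _; rewrite diam_cc.
by rewrite sumEFin lee_fin sumr_const card_ord -mulr_natl.
Qed.

(** The constant is 8 * 16: at the good scale r of generation n, the set E needs
    at most 8 * 2 ^ n intervals, and 2 ^ n * r ^ s is at most 16 times the bound
    on the sum of the given cover. *)
Lemma has_cover_comp_set (R : realType) (a : nat -> R)
  (a_pos : forall n, (1 <= n)%N -> 0 < a n)
  (a_noninc : forall m n, (1 <= m)%N -> (m <= n)%N -> a n <= a m)
  (a_sum : (\sum_(1 <= i < n) a i) @[n --> \oo] --> (1 : R))
  (E : set R) (theta s eps delta : R) :
  comp_sets a E -> 0 < eps -> delta < dyadic_tail a 1 ->
  has_cover (cantor_set a) theta s (eps / 128) delta ->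
  has_cover E theta s eps delta.
Proof.
move=> Ea eps0 delta1 /(cantor_cover_scale a_pos a_noninc a_sum) [||r [n]] //.
  by rewrite divr_gt0.
move=> [scale /andP[tr _] rs].
have r0 : 0 < r := lt_le_trans (dyadic_tail_gt0 a_pos a_sum _) tr.
have [pts ptsN ptsC] := comp_set_cover a_pos a_sum n.+2 Ea r0.
apply: (has_cover_of_points (ltW r0) scale ptsC).
have t1 : dyadic_tail a n.+2 / r <= 1 by rewrite ler_pdivrMr // mul1r.
have N8 : (size pts)%:R <= 8 * 2 ^+ n :> R.
  apply: le_trans ptsN _; apply: (@le_trans _ _ (2 ^+ n.+2 * (1 + 1))).
    by rewrite ler_wpM2l ?exprn_ge0 // lerD2l.
  by rewrite !exprS; lra.
apply: le_trans (ler_wpM2r (powR_ge0 r s) N8) _.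
by rewrite -mulrA; lra.
Qed.

(** * Comparison of the intermediate dimensions *)

Theorem lemma5p3 (R : realType) (a : nat -> R)
  (a_pos : forall n, (1 <= n)%N -> 0 < a n)
  (a_noninc : forall m n, (1 <= m)%N -> (m <= n)%N -> a n <= a m)
  (a_sum : (\sum_(1 <= i < n) a i) @[n --> \oo] --> (1 : R))
  (a_tail : ((dyadic_tail a n / dyadic_tail a n.+1) `^ (n%:R)^-1)
              @[n --> \oo] --> (1 : R)) :
  forall theta : R, 0 <= theta <= 1 ->
  forall E : set R, comp_sets a E ->
    (upper_idim theta E <= upper_idim theta (cantor_set a))%E /\
    (lower_idim theta E <= lower_idim theta (cantor_set a))%E.
Proof.
move=> theta _ E Ea; have d1 := dyadic_tail_gt0 a_pos a_sum 1.
have transfer := has_cover_comp_set a_pos a_noninc a_sum Ea.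
split; apply: ereal_inf_le_tmp => _ [s [s0 sC] <-]; exists s => //; split => //.
  move=> eps eps0; have [|delta0 [delta0_gt0 cov]] := sC (eps / 128).
    by rewrite divr_gt0.
  exists (Num.min delta0 (dyadic_tail a 1 / 2)).
  (* Halving makes delta strictly smaller than dyadic_tail a 1, as the choice
     of a generation requires. *)
  rewrite lt_min delta0_gt0 divr_gt0 //; split => // delta.
  rewrite le_min => /andP[delta_gt0 /andP[le0 le1]].
  apply: transfer => //; last by apply: cov; rewrite delta_gt0.
  by apply: le_lt_trans le1 _; lra.
move=> eps delta0 eps0 delta0_gt0.
have [||delta [+ cov]] := sC (eps / 128) (Num.min delta0 (dyadic_tail a 1 / 2)).
- by rewrite divr_gt0.
- by rewrite lt_min delta0_gt0 divr_gt0.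
rewrite le_min => /andP[delta_gt0 /andP[le0 le1]].
exists delta; rewrite delta_gt0 le0; split => //; apply: transfer => //.
by apply: le_lt_trans le1 _; lra.
Qed.
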